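(* Let $T=T_1\mathbf{e}_1+T_2\mathbf{e}_2$ be any operator on a bicomplex Hilbert space $\mathcal{H}=\mathcal{H}_1\mathbf{e}_1+\mathcal{H}_2\mathbf{e}_2$. If there is a sequence $\{K_n\}_{n=1}^\infty$ of bicomplex compact operators on $\mathcal{H}$ with $\|T-K_n\|_{\mathbb{H}}\to 0$, then $T$ is compact.
   Context: The bicomplex numbers $\mathbb{BC}$ are the elements $\zeta=z_1+jz_2$ with $z_1,z_2\in\mathbb{C}$, $i^2=j^2=-1$, $ij=ji$. Put $\mathbf{e}_1=(1+ij)/2$, $\mathbf{e}_2=(1-ij)/2$, so $\mathbf{e}_1^2=\mathbf{e}_1$, $\mathbf{e}_2^2=\mathbf{e}_2$, $\mathbf{e}_1\mathbf{e}_2=0$, and every $\zeta\in\mathbb{BC}$ is uniquely $\zeta=\zeta_1\mathbf{e}_1+\zeta_2\mathbf{e}_2$ with $\zeta_1,\zeta_2\in\mathbb{C}$. A bicomplex Hilbert space is $\mathcal{H}=\mathcal{H}_1\mathbf{e}_1+\mathcal{H}_2\mathbf{e}_2$, where $\mathcal{H}_1,\mathcal{H}_2$ are complex Hilbert spaces of the same dimension; its elements are $v=v_1\mathbf{e}_1+v_2\mathbf{e}_2$ with $v_i\in\mathcal{H}_i$, scalar multiplication is componentwise, and the hyperbolic norm is $\|v\|_{\mathbb{H}}=\|v_1\|\mathbf{e}_1+\|v_2\|\mathbf{e}_2$. Hyperbolic norm convergence or boundedness means norm convergence or boundedness of both components. A (linear) operator $T$ on $\mathcal{H}$ has the form $T=T_1\mathbf{e}_1+T_2\mathbf{e}_2$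 with $T_i$ a linear operator on $\mathcal{H}_i$, acting by $Tv=T_1v_1\mathbf{e}_1+T_2v_2\mathbf{e}_2$. The (hyperbolic) operator norm of a bounded operator is $\|T\|_{\mathbb{H}}=\|T_1\|\mathbf{e}_1+\|T_2\|\mathbf{e}_2$, and convergence to $0$ means both components converge to $0$. An operator $K$ on $\mathcal{H}$ is compact if for every bounded sequence $\{x_n\}$ in $\mathcal{H}$ the sequence $\{Kx_n\}$ has a hyperbolic norm-convergent subsequence. *)

(* Defs.v *)
From HB Require Import structures.
From mathcomp Require Import all_boot all_order all_algebra.
From mathcomp Require Import sesquilinear ring.
From mathcomp Require Import all_classical all_reals all_analysis.
From mathcomp Require Import complex.

Set Implicit Arguments.
Unset Strict Implicit.
Unset Printing Implicit Defensive.

Import Order.TTheory GRing.Theory Num.Theory.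
Import numFieldNormedType.Exports.

Local Open Scope classical_set_scope.
Local Open Scope ring_scope.
Local Open Scope card_scope.
Local Open Scope complex_scope.

(* The inner product is linear in its first argument, and the norm, which is
   R[i]-valued (and real), is the one that the inner product induces. *)
HB.mixin Record NormedModule_isHilbert (R : realType) H
    of CompleteNormedModule R[i] H := {
  hdot : {dot H for Num.conj} ;
  hdot_norm : forall x : H, `|x| ^+ 2 = hdot x x
}.

#[short(type="hilbertType")]
HB.structure Definition Hilbert (R : realType) :=
  {H of CompleteNormedModule R[i] H & NormedModule_isHilbert R H}.

Section HilbertDimension.
Context {R : realType}.

Definition orthonormal_set (H : hilbertType R) (B : set H) : Prop :=
  forall u v, B u -> B v -> hdot u v = (u == v)%:R.

Definition span (H : hilbertType R) (B : set H) : set H :=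
  [set x | exists (n : nat) (a : 'I_n -> R[i]) (b : 'I_n -> H),
     (forall i, B (b i)) /\ x = \sum_(i < n) a i *: b i].

Definition orthonormal_basis (H : hilbertType R) (B : set H) : Prop :=
  orthonormal_set B /\ closure (span B) = setT.

(* Dimension is Hilbert dimension: the cardinality of an orthonormal basis. *)
Definition same_dimension (H1 H2 : hilbertType R) : Prop :=
  exists (B1 : set H1) (B2 : set H2),
    [/\ orthonormal_basis B1, orthonormal_basis B2 & B1 #= B2].

End HilbertDimension.

(* Bicomplex z1 z2 is z1 + j z2. *)
Record bicomplex (R : Type) := Bicomplex { bcz1 : R[i]; bcz2 : R[i] }.

Definition pair_of_bicomplex (R : Type) (a : bicomplex R) := (bcz1 a, bcz2 a).
Definition bicomplex_of_pair (R : Type) (a : R[i] * R[i]) :=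
  Bicomplex a.1 a.2.

Lemma pair_of_bicomplexK (R : Type) :
  cancel (@pair_of_bicomplex R) (@bicomplex_of_pair R).
Proof. by case. Qed.

HB.instance Definition _ (R : realType) :=
  Choice.copy (bicomplex R) (can_type (@pair_of_bicomplexK R)).

Section BicomplexRing.
Context {R : realType}.
Local Notation BC := (bicomplex R).
Implicit Types a b c : BC.

Lemma bicomplex_eq a b : bcz1 a = bcz1 b -> bcz2 a = bcz2 b -> a = b.
Proof. by case: a b => [? ?] [? ?] /= -> ->. Qed.

Definition bcadd a b := Bicomplex (bcz1 a + bcz1 b) (bcz2 a + bcz2 b).
Definition bcopp a := Bicomplex (- bcz1 a) (- bcz2 a).
Definition bcmul a b :=
  Bicomplex (bcz1 a * bcz1 b - bcz2 a * bcz2 b)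
            (bcz1 a * bcz2 b + bcz2 a * bcz1 b).

Let bcaddA : associative bcadd.
Proof. by move=> *; apply: bicomplex_eq; exact: addrA. Qed.
Let bcaddC : commutative bcadd.
Proof. by move=> *; apply: bicomplex_eq; exact: addrC. Qed.
Let bcadd0 : left_id (Bicomplex 0 0) bcadd.
Proof. by move=> *; apply: bicomplex_eq; exact: add0r. Qed.
Let bcaddN : left_inverse (Bicomplex 0 0) bcopp bcadd.
Proof. by move=> *; apply: bicomplex_eq; exact: addNr. Qed.

HB.instance Definition _ :=
  GRing.isZmodule.Build BC bcaddA bcaddC bcadd0 bcaddN.

Let bcmulA : associative bcmul.
Proof. by move=> *; apply: bicomplex_eq => /=; ring. Qed.
Let bcmulC : commutative bcmul.
Proof. by move=> *; apply: bicomplex_eq => /=; ring. Qed.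
Let bcmul1 : left_id (Bicomplex 1 0) bcmul.
Proof. by move=> *; apply: bicomplex_eq => /=; ring. Qed.
Let bcmulD : left_distributive bcmul +%R.
Proof. by move=> *; apply: bicomplex_eq => /=; ring. Qed.
Let bc1_neq0 : Bicomplex 1 0 != 0 :> BC.
Proof. by apply/eqP => -[] /eqP; rewrite oner_eq0. Qed.

HB.instance Definition _ :=
  GRing.Zmodule_isComNzRing.Build BC bcmulA bcmulC bcmul1 bcmulD bc1_neq0.

Lemma bcz1D a b : bcz1 (a + b) = bcz1 a + bcz1 b. Proof. by []. Qed.
Lemma bcz2D a b : bcz2 (a + b) = bcz2 a + bcz2 b. Proof. by []. Qed.
Lemma bcz1N a : bcz1 (- a) = - bcz1 a. Proof. by []. Qed.
Lemma bcz2N a : bcz2 (- a) = - bcz2 a. Proof. by []. Qed.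
Lemma bcz1M a b : bcz1 (a * b) = bcz1 a * bcz1 b - bcz2 a * bcz2 b.
Proof. by []. Qed.
Lemma bcz2M a b : bcz2 (a * b) = bcz1 a * bcz2 b + bcz2 a * bcz1 b.
Proof. by []. Qed.
Lemma bcz1_1 : bcz1 (1 : BC) = 1. Proof. by []. Qed.
Lemma bcz2_1 : bcz2 (1 : BC) = 0. Proof. by []. Qed.

Definition bczE :=
  (bcz1D, bcz2D, bcz1N, bcz2N, bcz1M, bcz2M, bcz1_1, bcz2_1).

End BicomplexRing.

Section Idempotents.
Context {R : realType}.
Local Notation BC := (bicomplex R).
Implicit Types a b : BC.

(* The embedding of the complex numbers C(i). *)
Definition bcC (z : R[i]) : BC := Bicomplex z 0.
Definition bci : BC := bcC 'i%C.
Definition bcj : BC := Bicomplex 0 1.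
Definition bce1 : BC := bcC 2^-1 * (1 + bci * bcj).
Definition bce2 : BC := bcC 2^-1 * (1 - bci * bcj).

(* The coefficients in a = bcidem1 a e1 + bcidem2 a e2, obtained by expanding
   e1 = (1 + ij)/2 and e2 = (1 - ij)/2. *)
Definition bcidem1 a : R[i] := bcz1 a - 'i%C * bcz2 a.
Definition bcidem2 a : R[i] := bcz1 a + 'i%C * bcz2 a.

Lemma bciD (x y : R[i]) : bcC x * bce1 + bcC y * bce2 =
  Bicomplex (2^-1 * (x + y)) ('i%C * (2^-1 * (x - y))).
Proof.
apply: bicomplex_eq; rewrite !bczE /=.
- by set h := 2^-1; set I := 'i%C; move: h I => h I; ring.
- by set h := 2^-1; set I := 'i%C; move: h I => h I; ring.
Qed.

Lemma sqr_im : 'i%C * 'i%C = - 1 :> R[i].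
Proof. by rewrite -expr2 sqr_i. Qed.

Lemma bcidem1E x y : bcidem1 (bcC x * bce1 + bcC y * bce2) = x.
Proof. by rewrite bciD /bcidem1 /= mulrA sqr_im; field. Qed.

Lemma bcidem2E x y : bcidem2 (bcC x * bce1 + bcC y * bce2) = y.
Proof. by rewrite bciD /bcidem2 /= mulrA sqr_im; field. Qed.

Lemma bcidemE a : a = bcC (bcidem1 a) * bce1 + bcC (bcidem2 a) * bce2.
Proof.
rewrite bciD; apply: bicomplex_eq; rewrite /= /bcidem1 /bcidem2; first by field.
set u := bcz1 a; set v := bcz2 a.
have -> : 2^-1 * (u - 'i%C * v - (u + 'i%C * v)) = - ('i%C * v) by field.
by rewrite mulrN mulrA sqr_im mulN1r opprK.
Qed.

Lemma bcj2 : bcj * bcj = - 1 :> BC.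
Proof. by apply: bicomplex_eq; rewrite !bczE /=; ring. Qed.

Lemma bcidem11 : bcidem1 (1 : BC) = 1.
Proof. by rewrite /bcidem1 !bczE mulr0 subr0. Qed.
Lemma bcidem21 : bcidem2 (1 : BC) = 1.
Proof. by rewrite /bcidem2 !bczE mulr0 addr0. Qed.
Lemma bcidem1D a b : bcidem1 (a + b) = bcidem1 a + bcidem1 b.
Proof. by rewrite /bcidem1 !bczE; ring. Qed.
Lemma bcidem2D a b : bcidem2 (a + b) = bcidem2 a + bcidem2 b.
Proof. by rewrite /bcidem2 !bczE; ring. Qed.

Lemma bcidem1M a b : bcidem1 (a * b) = bcidem1 a * bcidem1 b.
Proof.
rewrite /bcidem1 !bczE; have := sqr_im; set I := 'i%C; move: I => I I2.
apply/eqP; rewrite -subr_eq0; apply/eqP.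
transitivity (- (1 + I * I) * (bcz2 a * bcz2 b)); first by ring.
by rewrite I2 subrr oppr0 mul0r.
Qed.

Lemma bcidem2M a b : bcidem2 (a * b) = bcidem2 a * bcidem2 b.
Proof.
rewrite /bcidem2 !bczE; have := sqr_im; set I := 'i%C; move: I => I I2.
apply/eqP; rewrite -subr_eq0; apply/eqP.
transitivity (- (1 + I * I) * (bcz2 a * bcz2 b)); first by ring.
by rewrite I2 subrr oppr0 mul0r.
Qed.

Lemma bcidemC z : bcidem1 (bcC z) = z /\ bcidem2 (bcC z) = z.
Proof. by rewrite /bcidem1 /bcidem2 /= mulr0 subr0 addr0. Qed.

Lemma bce1E : bce1 = bcC 1 * bce1 + bcC 0 * bce2.
Proof.
by rewrite [bcC 0](_ : _ = 0) // mul0r addr0 [bcC 1](_ : _ = 1) // mul1r. Qed.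

Lemma bce2E : bce2 = bcC 0 * bce1 + bcC 1 * bce2.
Proof.
by rewrite [bcC 0](_ : _ = 0) // mul0r add0r [bcC 1](_ : _ = 1) // mul1r. Qed.

Lemma bcidem_e1 : bcidem1 bce1 = 1 /\ bcidem2 bce1 = 0.
Proof. by rewrite bce1E bcidem1E bcidem2E. Qed.

Lemma bcidem_e2 : bcidem1 bce2 = 0 /\ bcidem2 bce2 = 1.
Proof. by rewrite bce2E bcidem1E bcidem2E. Qed.

Definition bc_cvg0 (u : nat -> BC) : Prop :=
  ((fun n => bcidem1 (u n)) @ \oo --> (0 : R[i]^o)) /\
  ((fun n => bcidem2 (u n)) @ \oo --> (0 : R[i]^o)).

End Idempotents.
Arguments bce1 {R}.
Arguments bce2 {R}.

Record bchilbert (R : realType) := BCHilbert {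
  bcH1 : hilbertType R ;
  bcH2 : hilbertType R ;
  bcH_dim : same_dimension bcH1 bcH2
}.

(* The pair (v1, v2) is v1 e1 + v2 e2. *)
Definition bcvec (R : realType) (H : bchilbert R) : Type :=
  (bcH1 H * bcH2 H)%type.

HB.instance Definition _ (R : realType) (H : bchilbert R) :=
  GRing.Zmodule.copy (bcvec H) (bcH1 H * bcH2 H)%type.

Section BicomplexModule.
Context {R : realType} (H : bchilbert R).
Local Notation BC := (bicomplex R).

Definition bcscale (a : BC) (v : bcvec H) : bcvec H :=
  (bcidem1 a *: v.1, bcidem2 a *: v.2).

Let bcscaleA a b v : bcscale a (bcscale b v) = bcscale (a * b) v.
Proof. by rewrite /bcscale /= !scalerA bcidem1M bcidem2M. Qed.
Let bcscale1 : left_id 1 bcscale.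
Proof. by case=> x y; rewrite /bcscale /= bcidem11 bcidem21 !scale1r. Qed.
Let bcscaleDr : right_distributive bcscale +%R.
Proof. by move=> a [x y] [x' y']; rewrite /bcscale /= !scalerDr. Qed.
Let bcscaleDl v : {morph bcscale^~ v : a b / a + b}.
Proof. by move=> a b; rewrite /bcscale /= bcidem1D bcidem2D !scalerDl. Qed.

HB.instance Definition _ := GRing.Zmodule_isLmodule.Build BC (bcvec H)
  bcscaleA bcscale1 bcscaleDr bcscaleDl.

Definition hypnorm (v : bcvec H) : BC := bcC `|v.1| * bce1 + bcC `|v.2| * bce2.

Definition hbounded (x : nat -> bcvec H) : Prop :=
  bounded_fun (fun n => (x n).1) /\ bounded_fun (fun n => (x n).2).

Definition hcvg (x : nat -> bcvec H) (l : bcvec H) : Prop :=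
  ((fun n => (x n).1) @ \oo --> l.1) /\ ((fun n => (x n).2) @ \oo --> l.2).

Lemma hcvg_hypnorm (x : nat -> bcvec H) (l : bcvec H) :
  hcvg x l <-> bc_cvg0 (fun n => hypnorm (x n - l)).
Proof.
have E (V : hilbertType R) (u : nat -> V) (y : V) :
    u @ \oo --> y <-> (fun n => `|u n - y|) @ \oo --> (0 : R[i]^o).
  by split=> [/subr_cvg0/norm_cvg0P|/norm_cvg0P/subr_cvg0].
rewrite /hcvg /bc_cvg0 !E.
under [X in _ <-> (X @ _ --> _) /\ _]eq_fun do rewrite bcidem1E.
under [X in _ <-> _ /\ (X @ _ --> _)]eq_fun do rewrite bcidem2E.
by [].
Qed.

End BicomplexModule.

(* The operator T1 e1 + T2 e2; its components need not be bounded. *)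
Record bcop (R : realType) (H : bchilbert R) := BCOp {
  bcop1 : {linear bcH1 H -> bcH1 H} ;
  bcop2 : {linear bcH2 H -> bcH2 H}
}.

Definition bcop_fun (R : realType) (H : bchilbert R) (T : bcop H)
  (v : bcvec H) : bcvec H := (bcop1 T v.1, bcop2 T v.2).

Coercion bcop_fun : bcop >-> Funclass.

Section BicomplexOperator.
Context {R : realType}.

Lemma bcop_is_linear (H : bchilbert R) (T : bcop H) : linear T.
Proof. by move=> a [x y] [x' y']; rewrite /bcop_fun /= !linearP. Qed.

(* Conversely, every linear map over the bicomplex numbers has this form. *)
Lemma bcop_surj (H : bchilbert R) (f : {linear bcvec H -> bcvec H}) :
  exists T : bcop H, T =1 f.
Proof.
pose f1 (x : bcH1 H) := (f (x, 0)).1; pose f2 (y : bcH2 H) := (f (0, y)).2.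
have f1l : linear f1.
  move=> c x x'; rewrite /f1.
  have -> : (c *: x + x', 0) = bcC c *: ((x, 0) : bcvec H) + (x', 0).
    by congr pair; rewrite /= ?(bcidemC c).1 // scaler0 addr0.
  by rewrite linearP /= (bcidemC c).1.
have f2l : linear f2.
  move=> c y y'; rewrite /f2.
  have -> : (0, c *: y + y') = bcC c *: ((0, y) : bcvec H) + (0, y').
    by congr pair; rewrite /= ?(bcidemC c).2 // scaler0 addr0.
  by rewrite linearP /= (bcidemC c).2.
pose F1 : {linear bcH1 H -> bcH1 H} :=
  HB.pack f1 (GRing.isLinear.Build _ _ _ _ f1 f1l).
pose F2 : {linear bcH2 H -> bcH2 H} :=
  HB.pack f2 (GRing.isLinear.Build _ _ _ _ f2 f2l).
exists (BCOp F1 F2) => -[x y]; rewrite /bcop_fun /= /f1 /f2.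
have -> : (x, 0) = bce1 *: ((x, y) : bcvec H).
  by congr pair; rewrite /= ?bcidem_e1.1 ?bcidem_e1.2 ?scale1r ?scale0r.
have -> : (0, y) = bce2 *: ((x, y) : bcvec H).
  by congr pair; rewrite /= ?bcidem_e2.1 ?bcidem_e2.2 ?scale1r ?scale0r.
rewrite !linearZ /= bcidem_e1.1 bcidem_e2.2 !scale1r.
by case: (f _).
Qed.

Definition bcop_sub (H : bchilbert R) (S T : bcop H) : bcop H :=
  BCOp (bcop1 S \- bcop1 T) (bcop2 S \- bcop2 T).

Definition bounded_op (V : normedModType R[i]) (f : V -> V) : Prop :=
  exists M : R[i], forall x, `|f x| <= M * `|x|.

(* Meaningful only for a bounded operator: sup of an unbounded set is 0.
   The norm of V is R[i]-valued but real, so Re loses nothing. *)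
Definition opnorm (V : normedModType R[i]) (f : V -> V) : R :=
  sup [set complex.Re `|f x| | x in [set x | `|x| <= 1]].

Definition bcop_bounded (H : bchilbert R) (T : bcop H) : Prop :=
  bounded_op (bcop1 T) /\ bounded_op (bcop2 T).

Definition hyp_opnorm (H : bchilbert R) (T : bcop H) : bicomplex R :=
  bcC (opnorm (bcop1 T))%:C * bce1 + bcC (opnorm (bcop2 T))%:C * bce2.

(* hyp_opnorm (T - K_n) tends to 0. The first conjunct says that these norms
   are defined; T itself is not assumed to be bounded. *)
Definition bcop_cvg (H : bchilbert R) (K : nat -> bcop H) (T : bcop H) : Prop :=
  (forall n, bcop_bounded (bcop_sub T (K n))) /\
  bc_cvg0 (fun n => hyp_opnorm (bcop_sub T (K n))).

Definition bcop_compact (H : bchilbert R) (K : bcop H) : Prop :=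
  forall x : nat -> bcvec H, hbounded x ->
    exists (phi : nat -> nat) (l : bcvec H),
      increasing_seq phi /\ hcvg (fun n => K (x (phi n))) l.

End BicomplexOperator.

(* Main.v *)
Require Import Defs.
From mathcomp Require Import all_boot all_algebra all_reals.
From mathcomp Require Import all_order all_classical all_analysis complex.

(** The problem splits along the idempotents: a bounded sequence in H is a pair
    of bounded sequences in the two component spaces, so T is compact exactly
    when both of its components are ([bcop_compactP]), and hyperbolic norm
    convergence is norm convergence in each component. What remains is the
    classical theorem that a norm limit of compact operators into a complete
    space is compact ([compact_op_limit]).

    For the latter, let x be a bounded sequence and K_n compact operators with
    K_n close to T for n large. Cantor's diagonal argument yields a single
    subsequence of x along which K_n x converges for every n
    ([diagonal_subsequence]). Along this subsequence T x is within any
    prescribed distance of the convergent sequence K_n x, for a suitable n, so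
    it is eventually in an arbitrarily small ball; it is therefore Cauchy, and
    it converges by completeness. The operator norm
    enters through [opnorm_le], which turns convergence of the norms of T - K_n into
    uniform closeness on bounded sets. *)

Set Implicit Arguments.
Unset Strict Implicit.
Unset Printing Implicit Defensive.

Import Order.TTheory GRing.Theory Num.Theory.
Import numFieldNormedType.Exports.

Local Open Scope classical_set_scope.
Local Open Scope ring_scope.
Local Open Scope complex_scope.

Lemma increasing_seq_comp (f g : nat -> nat) :
  increasing_seq f -> increasing_seq g -> increasing_seq (f \o g).
Proof. by move=> fi gi m n /=; rewrite fi; apply: gi. Qed.

Lemma increasing_seq_geq (f : nat -> nat) (n : nat) :
  increasing_seq f -> (n <= f n)%N.
Proof.
move=> /increasing_seqP fi; elim: n => // n IH.
by apply: (leq_ltn_trans IH); apply: fi.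
Qed.

Lemma increasing_seq_cvg (f : nat -> nat) :
  increasing_seq f -> f @ \oo --> \oo.
Proof.
move=> fi; apply/cvgnyPge => A; near=> n.
by apply: leq_trans (increasing_seq_geq n fi); near: n; exact: nbhs_infty_ge.
Unshelve. all: by end_near. Qed.

(** Cantor's diagonal argument: [Phi n.+1] refines [Phi n] so as to make the
    n-th sequence converge, and the diagonal [m |-> Phi m m] is, from the index
    n.+1 on, a reindexing of [Phi n.+1] that tends to infinity. *)
Lemma diagonal_subsequence (T : topologicalType) (z : nat -> nat -> T) :
  (forall n (phi : nat -> nat), increasing_seq phi ->
    exists (psi : nat -> nat) (l : T),
      increasing_seq psi /\ (fun m => z n (phi (psi m))) @ \oo --> l) ->
  exists2 d : nat -> nat, increasing_seq d &
    forall n, exists l : T, (fun m => z n (d m)) @ \oo --> l.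
Proof.
move=> hz.
have /choice[step stepP] (p : nat * (nat -> nat)) : exists psi : nat -> nat,
    increasing_seq p.2 -> increasing_seq psi /\
      exists l : T, (fun m => z p.1 (p.2 (psi m))) @ \oo --> l.
  case: p => n phi /=.
  have [phii|nphii] := pselect (increasing_seq phi); last by exists id.
  have [psi [l [psii psil]]] := hz n phi phii.
  by exists psi => _; split=> //; exists l.
pose Phi := fix Phi k : nat -> nat :=
  if k is k'.+1 then Phi k' \o step (k', Phi k') else id.
have Phii k : increasing_seq (Phi k).
  elim: k => [|k IH] //=.
  exact: increasing_seq_comp IH (stepP (k, Phi k) IH).1.
have tail k n : exists tau : nat -> nat,
    increasing_seq tau /\ Phi (n + k)%N =1 Phi k \o tau.
  elim: n => [|n [tau [taui tauE]]]; first by exists id.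
  exists (tau \o step ((n + k)%N, Phi (n + k)%N)); split.
    apply: increasing_seq_comp => //.
    exact: (stepP ((n + k)%N, Phi (n + k)%N) (Phii _)).1.
  by move=> m; rewrite /= tauE.
exists (fun m => Phi m m).
  apply/increasing_seqP => m; apply: (@lt_le_trans _ _ (Phi m m.+1)).
    by move/increasing_seqP: (Phii m); apply.
  rewrite /= (Phii m); apply: increasing_seq_geq.
  exact: (stepP (m, Phi m) (Phii m)).1.
move=> n; have [tau tauP] := choice (tail n.+1).
have [_ [l zl]] := stepP (n, Phi n) (Phii n).
(* The diagonal at m is [Phi n.+1 (h m)] as soon as m >= n.+1. *)
exists l; pose h m := tau (m - n.+1)%N m.
have hoo : h @ \oo --> \oo.
  apply/cvgnyPge => A; near=> m.
  apply: leq_trans (increasing_seq_geq m (tauP _).1).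
  by near: m; exact: nbhs_infty_ge.
apply: cvg_trans (cvg_comp _ _ hoo zl); apply: near_eq_cvg; near=> m.
have nm : (n < m)%N by near: m; exact: nbhs_infty_ge.
have := (tauP (m - n.+1)%N).2 m; rewrite subnK // => ->.
Unshelve. all: by end_near. Qed.

(** The one-component counterpart of [bcop_compact], for a map
    between possibly different normed spaces. *)
Definition compact_op (K : numFieldType) (V W : normedModType K)
    (f : V -> W) : Prop :=
  forall x : nat -> V, bounded_fun x ->
    exists (phi : nat -> nat) (l : W),
      increasing_seq phi /\ (fun n => f (x (phi n))) @ \oo --> l.

Lemma bounded_fun_comp (K : numFieldType) (V : normedModType K) (S S' : Type)
    (x : S -> V) (phi : S' -> S) : bounded_fun x -> bounded_fun (x \o phi).
Proof.
by move=> [M [Mr Mx]]; exists M; split=> // N MN n _; exact: (Mx N MN (phi n)).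
Qed.

(** A norm limit of compact operators is compact: on the bounded sequence x,
    the images under f are uniformly approximated by the images under a
    suitable [g n], and one subsequence serves all the [g n] at once. *)
Lemma compact_op_limit (K : numFieldType) (V : normedModType K)
    (W : completeNormedModType K) (f : V -> W) (g : nat -> V -> W) :
  (forall n, compact_op (g n)) ->
  (forall e : K, 0 < e -> exists n, forall x, `|f x - g n x| <= e * `|x|) ->
  compact_op f.
Proof.
move=> gc fg x xb.
have [M M0 xM] : exists2 M : K, 0 < M & forall n, `|x n| <= M.
  case: xb => M [Mr Mx]; exists (`|M| + 1); first by rewrite ltr_wpDl.
  move=> n; apply: (Mx (`|M| + 1)) => //.
  by apply: le_lt_trans (real_ler_norm Mr) _; rewrite ltrDl.
have [n phi phii|d di dl] := @diagonal_subsequence W (fun n m => g n (x m)).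
  exact: gc n (x \o phi) (bounded_fun_comp phi xb).
suff /cauchy_cvg fc : cauchy ((fun m => f (x (d m))) @ \oo).
  by exists d, (lim ((fun m => f (x (d m))) @ \oo)).
(* It suffices to find, for each e, one ball of radius e that contains a tail
   of the sequence; its centre is the limit l of [g n] for a good enough n. *)
apply: cauchy_exP => e e0.
have e20 : 0 < e / 2 by rewrite divr_gt0.
have [n fgn] := fg (e / 2 / M) (divr_gt0 e20 M0).
have [l gl] := dl n; exists l.
have [N _ gN] : \forall m \near \oo, `|l - g n (x (d m))| < e / 2.
  exact: (cvgr_dist_lt _ _ gl).
exists N => // m Nm; rewrite /= -ball_normE /=.
rewrite -(subrK (g n (x (d m))) l) -addrA (le_lt_trans (ler_normD _ _)) //.
rewrite [ltRHS]splitr ltr_leD ?gN // distrC (le_trans (fgn _)) //.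
by rewrite -[leRHS](divfK (lt0r_neq0 M0)) ler_wpM2l // divr_ge0 // ltW.
Qed.

Section OperatorNorm.
Context {R : realType} (V : normedModType R[i]).

Lemma normc_Re (x : V) : (complex.Re `|x|)%:C = `|x|.
Proof. by rewrite RRe_real // normr_real. Qed.

(** By linearity, the bound on the unit ball scales to every vector. The
    boundedness hypothesis is essential: it makes the set whose supremum
    defines [opnorm] bounded above. *)
Lemma opnorm_le (f : {linear V -> V}) (x : V) :
  bounded_op f -> `|f x| <= (opnorm f)%:C * `|x|.
Proof.
move=> [M fM]; have [->|x0] := eqVneq x 0.
  by rewrite linear0 !normr0 mulr0.
have nx0 : 0 < `|x| by rewrite normr_gt0.
rewrite -ler_pdivrMr // mulrC.
pose y := `|x|^-1 *: x.
have nV : `| `|x|^-1 | = `|x|^-1 by rewrite ger0_norm // invr_ge0.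
have -> : `|x|^-1 * `|f x| = `|f y| by rewrite /y linearZ /= normrZ nV.
rewrite -normc_Re lecR; apply: ub_le_sup.
  exists (complex.Re `|M|) => _ /= [v v1 <-].
  rewrite -lecR normc_Re -[leRHS]/(`|M|).
  have M0 : 0 <= M * `|v| by apply: le_trans (fM v).
  apply: (le_trans (fM v)); rewrite -(ger0_norm M0) normrM normr_id.
  by rewrite ler_piMr.
by exists y => //=; rewrite normrZ nV mulVf // gt_eqF.
Qed.

Lemma opnorm_cvg0_approx (f : {linear V -> V}) (g : nat -> {linear V -> V}) :
  (forall n, bounded_op (f \- g n)) ->
  (fun n => (opnorm (f \- g n))%:C) @ \oo --> (0 : R[i]^o) ->
  forall e : R[i], 0 < e -> exists n, forall x, `|f x - g n x| <= e * `|x|.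
Proof.
move=> fgb fg0 e e0.
have [N _ fgN] : \forall n \near \oo, `|(opnorm (f \- g n))%:C| < e.
  exact: (cvgr0_norm_lt (V := R[i]^o) _ fg0).
exists N => x; apply: (le_trans (opnorm_le (f := f \- g N) x (fgb N))).
rewrite ler_wpM2r // (le_trans (real_ler_norm _)) ?complex_real //.
by apply: ltW; apply: fgN => /=.
Qed.

End OperatorNorm.

Section BicomplexCompact.
Context {R : realType} (H : bchilbert R).

(** For necessity, each component space embeds in H by putting 0 in the other
    component. For sufficiency, the subsequence that suits the first component
    is refined to suit the second, which keeps the first limit. *)
Lemma bcop_compactP (T : bcop H) :
  bcop_compact T <-> compact_op (bcop1 T) /\ compact_op (bcop2 T).
Proof.
have b0 (V : normedModType R[i]) : bounded_fun (fun _ : nat => 0 : V).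
  by exists 0; split=> // M M0 n _; rewrite /= normr0 ltW.
split=> [Tc|[T1c T2c] x [x1b x2b]].
  split=> x xb.
    have [phi [l [phii [Tl _]]]] := Tc (fun n => (x n, 0)) (conj xb (b0 _)).
    by exists phi, l.1.
  have [phi [l [phii [_ Tl]]]] := Tc (fun n => (0, x n)) (conj (b0 _) xb).
  by exists phi, l.2.
have [phi [l1 [phii T1l]]] := T1c _ x1b.
have [psi [l2 [psii T2l]]] := T2c _ (bounded_fun_comp phi x2b).
exists (phi \o psi), (l1, l2); split; first exact: increasing_seq_comp.
split=> //; exact: cvg_comp (increasing_seq_cvg psii) T1l.
Qed.

End BicomplexCompact.

Theorem theorem6 (R : realType) (H : bchilbert R) (T : bcop H)
    (K : nat -> bcop H) :
  (forall n : nat, bcop_compact (K n)) -> bcop_cvg K T -> bcop_compact T.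
Proof.
move=> Kc [TKb [TK1 TK2]]; apply/bcop_compactP; split.
- apply: (@compact_op_limit _ _ _ _ (fun n => bcop1 (K n))) => [n|].
    by have /bcop_compactP[] := Kc n.
  apply: opnorm_cvg0_approx => [n|]; first exact: (TKb n).1.
  by move: TK1; under eq_fun do rewrite /hyp_opnorm bcidem1E.
- apply: (@compact_op_limit _ _ _ _ (fun n => bcop2 (K n))) => [n|].
    by have /bcop_compactP[] := Kc n.
  apply: opnorm_cvg0_approx => [n|]; first exact: (TKb n).2.
  by move: TK2; under eq_fun do rewrite /hyp_opnorm bcidem2E.
Qed.
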